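(* The proof system $\mathbf{E}^\circ$ is sound and strongly complete with respect to the class of all neighborhood frames.
   Context: Fix a nonempty set $\mathbf{P}$ of propositional variables, $p\in\mathbf{P}$. $\mathcal{L}(\bullet)$: $\varphi::=p\mid\neg\varphi\mid\varphi\land\varphi\mid\bullet\varphi$; other Boolean connectives are defined as usual and $\circ\varphi$ abbreviates $\neg\bullet\varphi$. A neighborhood frame is $\langle S,N\rangle$ with $S$ a nonempty set and $N:S\to\mathcal{P}(\mathcal{P}(S))$; a model $\mathcal{M}=\langle S,N,V\rangle$ based on it adds $V:\mathbf{P}\to\mathcal{P}(S)$. With $\varphi^{\mathcal{M}}=\{s\in S\mid\mathcal{M},s\vDash\varphi\}$: $\mathcal{M},s\vDash p$ iff $s\in V(p)$; Boolean connectives as usual; $\mathcal{M},s\vDash\bullet\varphi$ iff $s\in\varphi^{\mathcal{M}}$ and $\varphi^{\mathcal{M}}\notin N(s)$. The proof system $\mathbf{E}^\circ$ for $\mathcal{L}(\bullet)$ has as axioms all instances of propositional tautologies and all instances of $\circ\texttt{E}$: $\bullet\varphi\to\varphi$; its rules are modus ponens and $\texttt{RE}\circ$: from $\varphi\leftrightarrow\psi$ infer $\circ\varphi\leftrightarrow\circ\psi$ (applied to theorems). Sound with respect to a class of frames: every theorem is true at every state of every model based on a frame in the class. Strongly complete: for every set $\Gamma\cup\{\varphi\}$ of formulas, if $\varphi$ is true at every state, in every model based on a frame in the class, at which all of $\Gamma$ is true, then $\vdash\bigwedge\Gamma_0\to\varphi$ for some finite $\Gamma_0\subseteq\Gamma$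 (equivalently, every consistent set is satisfiable in a model based on a frame in the class). *)

(* Defs.v *)
From Stdlib Require List.
From mathcomp Require Import all_boot.
From mathcomp Require Import classical_sets.

Set Implicit Arguments.
Unset Strict Implicit.
Unset Printing Implicit Defensive.

Local Open Scope classical_set_scope.

Inductive formula (P : Type) : Type :=
| Var of P
| Neg of formula P
| And of formula P & formula P
| Bullet of formula P.

Definition Imp {P : Type} (f g : formula P) : formula P := Neg (And f (Neg g)).
Definition Iff {P : Type} (f g : formula P) : formula P :=
  And (Imp f g) (Imp g f).
Definition Circ {P : Type} (f : formula P) : formula P := Neg (Bullet f).

(* The language has no primitive constant for truth; it is defined from an
   arbitrary variable and serves as the conjunction of the empty list. *)
Definition Top {P : Type} (p0 : P) : formula P :=
  Neg (And (Var p0) (Neg (Var p0))).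
Definition BigAnd {P : Type} (p0 : P) (fs : seq (formula P)) : formula P :=
  foldr (@And P) (Top p0) fs.

Record nframe : Type := NFrame {
  state :> Type;
  state_inhabited : inhabited state;
  nbhd : state -> set (set state) }.

Record nmodel (P : Type) : Type := NModel {
  frame_of :> nframe;
  valuation : P -> set frame_of }.

Fixpoint sat {P : Type} (M : nmodel P) (s : M) (f : formula P) : Prop :=
  match f with
  | Var p => valuation p s
  | Neg g => ~ sat s g
  | And g h => sat s g /\ sat s h
  | Bullet g => sat s g /\ ~ nbhd s [set t : M | sat t g]
  end.

(* Purely propositional formulas have their own countable stock of letters:
   [P] may be finite, and substitution instances of tautologies written with
   too few letters would not suffice. *)
Inductive pformula : Type :=
| PVar of nat
| PNeg of pformula
| PAnd of pformula & pformula.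

Fixpoint peval (v : nat -> bool) (a : pformula) : bool :=
  match a with
  | PVar n => v n
  | PNeg b => ~~ peval v b
  | PAnd b c => peval v b && peval v c
  end.

Definition tautology (a : pformula) : Prop := forall v, peval v a.

Fixpoint psubst {P : Type} (sigma : nat -> formula P) (a : pformula) :
    formula P :=
  match a with
  | PVar n => sigma n
  | PNeg b => Neg (psubst sigma b)
  | PAnd b c => And (psubst sigma b) (psubst sigma c)
  end.

Inductive Ecirc {P : Type} : formula P -> Prop :=
| Ecirc_taut a sigma : tautology a -> Ecirc (psubst sigma a)
| Ecirc_circE f : Ecirc (Imp (Bullet f) f)
| Ecirc_MP f g : Ecirc (Imp f g) -> Ecirc f -> Ecirc g
| Ecirc_RE f g : Ecirc (Iff f g) -> Ecirc (Iff (Circ f) (Circ g)).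

(* [thm] is the set of theorems of a proof system, [C] a class of frames. *)
Definition sound {P : Type} (thm : formula P -> Prop) (C : nframe -> Prop) :
    Prop :=
  forall f, thm f -> forall M : nmodel P, C M -> forall s : M, sat s f.

Definition entails {P : Type} (C : nframe -> Prop) (G : set (formula P))
    (f : formula P) : Prop :=
  forall M : nmodel P, C M ->
  forall s : M, (forall g, G g -> sat s g) -> sat s f.

Definition strongly_complete {P : Type} (p0 : P) (thm : formula P -> Prop)
    (C : nframe -> Prop) : Prop :=
  forall (G : set (formula P)) (f : formula P), entails C G f ->
  exists G0 : seq (formula P), List.Forall G G0 /\ thm (Imp (BigAnd p0 G0) f).

Definition all_nframes : nframe -> Prop := fun _ => True.

(* Main.v *)
Require Import Defs.
From Stdlib Require List.
From mathcomp Require Import all_boot.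
From mathcomp Require Import boolp classical_sets.

(** Completeness is by a canonical model whose states are the maximal consistent
    sets, with [N(s) = { |f| : Circ f \in s }], where [|f|] is the set of states
    containing [f]. This is well defined: by Lindenbaum's lemma [|f| = |g|]
    forces [f <-> g] to be a theorem, so RE makes [Circ f] and [Circ g]
    interchangeable, and the axiom [Bullet f -> f] supplies the other half of the
    truth condition for [Bullet]. Since there may be uncountably many variables,
    Lindenbaum's lemma uses Zorn's lemma. *)

Set Implicit Arguments.
Unset Strict Implicit.
Unset Printing Implicit Defensive.

Local Open Scope classical_set_scope.

(** * Soundness over all frames *)

Section Soundness.
Variable P : Type.

Lemma sat_Imp (M : nmodel P) (s : M) f g :
  sat s (Imp f g) <-> (sat s f -> sat s g).
Proof.
split=> [/= nfg sf | sfg /= [sf]]; last by apply; exact: sfg.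
by apply: contrapT => nsg; apply: nfg.
Qed.

Lemma sat_Iff (M : nmodel P) (s : M) f g :
  sat s (Iff f g) <-> (sat s f <-> sat s g).
Proof.
split=> [[/sat_Imp fg /sat_Imp gf] // | [fg gf]].
by split; apply/sat_Imp.
Qed.

(** Classical truth at [s] is a Boolean valuation of the letters, so tautologies hold at [s]. *)
Lemma sat_psubst (M : nmodel P) (s : M) (sigma : nat -> formula P) a :
  sat s (psubst sigma a) <-> peval (fun n => `[< sat s (sigma n) >]) a.
Proof.
elim: a => [n | a IHa | a IHa b IHb] /=.
- by split=> /asboolP.
- by rewrite IHa; split=> /negP.
- by rewrite IHa IHb; split=> [[-> ->] | /andP].
Qed.

Lemma Ecirc_sound : sound (@Ecirc P) all_nframes.
Proof.
move=> f; elim=> {f} [a sigma taut | f | f g _ IHfg _ IHf | f g _ IH] M CM s.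
- by apply/sat_psubst/taut.
- by apply/sat_Imp => -[].
- by have /sat_Imp := IHfg M CM s; apply; exact: IHf.
(* The induction hypothesis holds at every state [t], not just at [s], so the two truth sets are
   equal and [nbhd] cannot separate them. *)
- have fg t : sat t f <-> sat t g by apply/sat_Iff/IH.
  have eqfg : [set t : M | sat t f] = [set t : M | sat t g].
    by apply/seteqP; split=> t /=; rewrite fg.
  by apply/sat_Iff; rewrite /= eqfg fg.
Qed.

End Soundness.

Section Completeness.
Variables (P : Type) (p0 : P).
Implicit Types (f g h : formula P) (D G X : set (formula P)).

(** * Propositional reasoning in the calculus *)

Let PImp a b := PNeg (PAnd a (PNeg b)).
Let letters (s : seq (formula P)) := nth (Var p0) s.

Lemma Ecirc_Top : Ecirc (Top p0).
Proof.
(* The empty list sends every letter to the default [Var p0], so this instance is exactly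
   [Top p0]. *)
apply: (@Ecirc_taut _ (PNeg (PAnd (PVar 0) (PNeg (PVar 0)))) (letters [::])).
by move=> v /=; case: (v 0).
Qed.

Lemma Ecirc_K f g : Ecirc (Imp f (Imp g f)).
Proof.
apply: (@Ecirc_taut _ (PImp (PVar 0) (PImp (PVar 1) (PVar 0)))
  (letters [:: f; g])).
by move=> v /=; case: (v 0); case: (v 1).
Qed.

Lemma Ecirc_S f g h :
  Ecirc (Imp (Imp f (Imp g h)) (Imp (Imp f g) (Imp f h))).
Proof.
apply: (@Ecirc_taut _
  (PImp (PImp (PVar 0) (PImp (PVar 1) (PVar 2)))
    (PImp (PImp (PVar 0) (PVar 1)) (PImp (PVar 0) (PVar 2))))
  (letters [:: f; g; h])).
by move=> v /=; case: (v 0); case: (v 1); case: (v 2).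
Qed.

Lemma Ecirc_andl f g : Ecirc (Imp (And f g) f).
Proof.
apply: (@Ecirc_taut _ (PImp (PAnd (PVar 0) (PVar 1)) (PVar 0))
  (letters [:: f; g])).
by move=> v /=; case: (v 0); case: (v 1).
Qed.

Lemma Ecirc_andr f g : Ecirc (Imp (And f g) g).
Proof.
apply: (@Ecirc_taut _ (PImp (PAnd (PVar 0) (PVar 1)) (PVar 1))
  (letters [:: f; g])).
by move=> v /=; case: (v 0); case: (v 1).
Qed.

Lemma Ecirc_andI f g : Ecirc (Imp f (Imp g (And f g))).
Proof.
apply: (@Ecirc_taut _
  (PImp (PVar 0) (PImp (PVar 1) (PAnd (PVar 0) (PVar 1))))
  (letters [:: f; g])).
by move=> v /=; case: (v 0); case: (v 1).
Qed.

Lemma Ecirc_explosion f g : Ecirc (Imp f (Imp (Neg f) g)).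
Proof.
apply: (@Ecirc_taut _ (PImp (PVar 0) (PImp (PNeg (PVar 0)) (PVar 1)))
  (letters [:: f; g])).
by move=> v /=; case: (v 0); case: (v 1).
Qed.

Lemma Ecirc_cases f g : Ecirc (Imp (Imp f g) (Imp (Imp (Neg f) g) g)).
Proof.
apply: (@Ecirc_taut _
  (PImp (PImp (PVar 0) (PVar 1))
    (PImp (PImp (PNeg (PVar 0)) (PVar 1)) (PVar 1)))
  (letters [:: f; g])).
by move=> v /=; case: (v 0); case: (v 1).
Qed.

Lemma Ecirc_weaken f g : Ecirc f -> Ecirc (Imp g f).
Proof. exact/Ecirc_MP/Ecirc_K. Qed.

Lemma Ecirc_imp_MP f g h :
  Ecirc (Imp f (Imp g h)) -> Ecirc (Imp f g) -> Ecirc (Imp f h).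
Proof. by move=> fgh; apply/Ecirc_MP/(Ecirc_MP _ fgh)/Ecirc_S. Qed.

Lemma Ecirc_id f : Ecirc (Imp f f).
Proof. exact: Ecirc_imp_MP (Ecirc_K f (Imp f f)) (Ecirc_K f f). Qed.

Lemma Ecirc_trans f g h :
  Ecirc (Imp f g) -> Ecirc (Imp g h) -> Ecirc (Imp f h).
Proof. by move=> fg gh; apply: Ecirc_imp_MP fg; exact: Ecirc_weaken. Qed.

Lemma Ecirc_imp_and f g h :
  Ecirc (Imp f g) -> Ecirc (Imp f h) -> Ecirc (Imp f (And g h)).
Proof.
by move=> fg; apply: Ecirc_imp_MP; apply: Ecirc_trans fg (Ecirc_andI g h).
Qed.

(** The order [g], [f] suits the deduction theorem: the head of a [BigAnd] moves into the conclusion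
    and the tail stays as premise. *)
Lemma Ecirc_curry f g h : Ecirc (Imp (And f g) h) -> Ecirc (Imp g (Imp f h)).
Proof.
move=> fgh.
have f_gh : Ecirc (Imp g (Imp f (Imp (And f g) h))).
  by do 2![apply: Ecirc_weaken].
have g_fg : Ecirc (Imp g (Imp f (And f g))).
  apply: Ecirc_imp_MP (Ecirc_K g f).
  apply: Ecirc_trans (Ecirc_S _ _ _).
  exact/Ecirc_weaken/Ecirc_andI.
exact: Ecirc_imp_MP (Ecirc_trans f_gh (Ecirc_S _ _ _)) g_fg.
Qed.

Lemma BigAnd_catl L1 L2 :
  Ecirc (Imp (BigAnd p0 (L1 ++ L2)) (BigAnd p0 L1)).
Proof.
elim: L1 => [|f L IH] /=; first exact/Ecirc_weaken/Ecirc_Top.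
exact: Ecirc_imp_and (Ecirc_andl _ _) (Ecirc_trans (Ecirc_andr _ _) IH).
Qed.

Lemma BigAnd_catr L1 L2 :
  Ecirc (Imp (BigAnd p0 (L1 ++ L2)) (BigAnd p0 L2)).
Proof.
elim: L1 => [|f L IH] /=; first exact: Ecirc_id.
exact: Ecirc_trans (Ecirc_andr _ _) IH.
Qed.

(** * Derivability from a set of formulas *)

Definition derivable D f :=
  exists L, List.Forall D L /\ Ecirc (Imp (BigAnd p0 L) f).

Lemma derivable_thm D f : Ecirc f -> derivable D f.
Proof. by exists [::]; split; [constructor | exact: Ecirc_weaken]. Qed.

Lemma derivable_hyp D f : D f -> derivable D f.
Proof.
by exists [:: f]; split; [constructor | exact: Ecirc_andl].
Qed.

Lemma derivable_MP D f g :
  derivable D (Imp f g) -> derivable D f -> derivable D g.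
Proof.
move=> [L1 [DL1 L1fg]] [L2 [DL2 L2f]]; exists (L1 ++ L2).
split; first exact/List.Forall_app.
apply: Ecirc_imp_MP (Ecirc_trans (BigAnd_catr _ _) L2f).
exact: Ecirc_trans (BigAnd_catl _ _) L1fg.
Qed.

(** Induction on the premises with [f] general: the head [h] moves into the conclusion and is then
    discharged, since [g] derivably implies it whether [h] is in [D] or is [g]. *)
Lemma derivable_deduction D g f :
  derivable (D `|` [set g]) f -> derivable D (Imp g f).
Proof.
move=> [L]; elim: L f => [|h L IH] f [DL Lf].
  exact/derivable_thm/Ecirc_weaken/(Ecirc_MP Lf)/Ecirc_Top.
have [Dh DL'] : (D `|` [set g]) h /\ List.Forall (D `|` [set g]) L.
  exact/List.Forall_cons_iff.
have D_ghf : derivable D (Imp g (Imp h f)).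
  by apply: IH; split=> //; exact: Ecirc_curry.
have D_gh_gf := derivable_MP (derivable_thm D (Ecirc_S g h f)) D_ghf.
apply: (derivable_MP D_gh_gf).
case: Dh => [Dh | ->]; last exact/derivable_thm/Ecirc_id.
exact: derivable_MP (derivable_thm _ (Ecirc_K h g)) (derivable_hyp Dh).
Qed.

Lemma derivable_set0 f : derivable set0 f -> Ecirc f.
Proof.
move=> [[|g L] [DL Lf]]; first exact: Ecirc_MP Lf Ecirc_Top.
by have /List.Forall_cons_iff[] := DL.
Qed.

(** * Maximal consistent sets *)

Definition maxcons D :=
  (forall g, derivable D g -> D g) /\ (forall g, D (Neg g) <-> ~ D g).

(** A finite list draws on finitely many members of the chain, and the largest of them contains all
    that is used. The case [set0] covers lists inside [G], in particular when the chain is empty. *)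
Lemma Forall_chain G (F : set (set (formula P))) L :
  total_on F subset -> List.Forall (G `|` \bigcup_(X in F) X) L ->
  exists2 X, X = set0 \/ F X & List.Forall (G `|` X) L.
Proof.
move=> Ftot; elim: L => [_|f L IH /List.Forall_cons_iff [Gf /IH]].
  by exists set0; [left | constructor].
case=> X FX GL; have sub Y Z : Y `<=` Z ->
    List.Forall (G `|` Y) L -> List.Forall (G `|` Z) L.
  by move=> YZ; apply: List.Forall_impl; exact: setUS.
case: Gf => [Gf | [Y FY Yf]].
  by exists X => //; constructor=> //; left.
case: FX => [X0 | FX].
  exists Y; first by right.
  by constructor; [right | apply: sub GL; rewrite X0; exact: sub0set].
have [XY | YX] := Ftot _ _ FX FY.
  by exists Y; [right | constructor; [right | exact: sub GL]].
by exists X; [right | constructor=> //; right; exact: YX].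
Qed.

(* Maximality among the sets not deriving [f] already gives negation
   completeness: if neither [g] nor [Neg g] belonged to [D], then [D] would
   derive [f] from each of them, hence outright. *)
Lemma Lindenbaum G f :
  ~ derivable G f -> exists D, [/\ G `<=` D, maxcons D & ~ D f].
Proof.
move=> Gf; pose Q X := ~ derivable (G `|` X) f.
(* Since [Q] adjoins [G] itself, the union of the empty chain also satisfies [Q]. *)
have [F FQ Ftot | A [QA Amax]] := @Zorn_bigcup _ Q.
  move=> [L [/(Forall_chain Ftot)[X FX GL] Lf]].
  case: FX GL => [-> | FX] GL; last by apply: (FQ X FX); exists L.
  by apply: Gf; exists L; rewrite setU0 in GL.
pose D := G `|` A.
have D_imp g : ~ D g -> derivable D (Imp g f).
  move=> Dg; apply: contrapT => Dgf; apply: (Amax (A `|` [set g])).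
    split; last by move=> /(_ g (or_intror erefl)) Ag; apply: Dg; right.
    exact: subsetUl.
  by rewrite /Q setUA => /derivable_deduction.
have D_closed g : derivable D g -> D g.
  by move=> Dg; apply: contrapT => /D_imp/derivable_MP/(_ Dg).
exists D; split; [exact: subsetUl | split=> // g; split | ].
- move=> /derivable_hyp DNg /derivable_hyp Dg; apply: QA.
  apply: derivable_MP DNg; apply: derivable_MP Dg.
  exact/derivable_thm/Ecirc_explosion.
- move=> /D_imp Dgf; apply: contrapT => /D_imp DNgf; apply: QA.
  apply: derivable_MP DNgf; apply: derivable_MP Dgf.
  exact/derivable_thm/Ecirc_cases.
- by move=> /derivable_hyp.
Qed.

Lemma maxcons_MP D f g : maxcons D -> Ecirc (Imp f g) -> D f -> D g.
Proof.
move=> [Dcl _] fg Df; apply: Dcl.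
exact: derivable_MP (derivable_thm D fg) (derivable_hyp Df).
Qed.

Lemma maxcons_And D f g : maxcons D -> D (And f g) <-> D f /\ D g.
Proof.
move=> mD; split=> [Dfg | [Df Dg]].
  by split; apply: maxcons_MP Dfg; [| exact: Ecirc_andl | | exact: Ecirc_andr].
apply: mD.1; apply: derivable_MP (derivable_hyp Dg).
exact: derivable_MP (derivable_thm D (Ecirc_andI f g)) (derivable_hyp Df).
Qed.

(** Otherwise [g] is not derivable from [f] alone, and a Lindenbaum extension of [[set f]] omits
    [g]. *)
Lemma Ecirc_of_maxcons f g :
  (forall D, maxcons D -> D f -> D g) -> Ecirc (Imp f g).
Proof.
move=> fg; apply/derivable_set0/derivable_deduction; rewrite set0U.
apply: contrapT => /Lindenbaum[D [fD mD]]; apply.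
by apply: fg => //; exact: fD.
Qed.

(** * The canonical model *)

Definition cstate := {D | maxcons D}.

Definition cextent f : set cstate := [set s | sval s f].

(** [D0] supplies the inhabitant that a frame must have. *)
Definition canonical (D0 : cstate) : nmodel P :=
  @NModel P
    (@NFrame cstate (inhabits D0)
      (fun s => [set Y | exists2 f, Y = cextent f & sval s (Circ f)]))
    (fun p => cextent (Var p)).

Lemma cextent_inj_Circ (D : cstate) f g :
  cextent f = cextent g -> sval D (Circ f) -> sval D (Circ g).
Proof.
move=> fg; apply: (maxcons_MP (svalP D)).
have sub h k : cextent h = cextent k -> Ecirc (Imp h k).
  move=> hk; apply: Ecirc_of_maxcons => E mE Eh.
  have : cextent h (exist _ E mE) by [].
  by rewrite hk.
have Efg : Ecirc (Iff f g).
  apply: Ecirc_MP (sub _ _ (esym fg)).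
  exact: Ecirc_MP (Ecirc_andI _ _) (sub _ _ fg).
exact: Ecirc_MP (Ecirc_andl _ _) (Ecirc_RE Efg).
Qed.

Lemma canonical_truth (D0 : cstate) f (D : canonical D0) : sat D f <-> sval D f.
Proof.
elim: f D => [p | f IH | f IHf g IHg | f IH] D //=.
- by rewrite IH (svalP D).2.
- by rewrite IHf IHg maxcons_And //; exact: svalP.
have -> : [set E : canonical D0 | sat E f] = cextent f.
  by apply/seteqP; split=> E /IH.
have CircE := (svalP D).2 (Bullet f); rewrite IH; split=> [[Df nN] | DBf].
  by apply: contrapT => /CircE DCf; apply: nN; exists f.
split; first exact: maxcons_MP (svalP D) (Ecirc_circE f) DBf.
(* The witness [g] shares only its extent with [f], so [Circ g] must be transferred to [Circ f],
   which contradicts [Bullet f]. *)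
move=> [g fg DCg].
by have /CircE := cextent_inj_Circ (esym fg) DCg.
Qed.

(** If [G] does not derive [f], a Lindenbaum extension of [G] omitting [f] is a canonical state
    where [G] holds and [f] fails. *)
Lemma Ecirc_strongly_complete :
  strongly_complete p0 (@Ecirc P) all_nframes.
Proof.
move=> G f Gf; apply: contrapT => /Lindenbaum[D [GD mD]]; apply.
pose D0 : cstate := exist _ D mD.
apply/(@canonical_truth D0 f D0); apply: Gf => // g Gg.
by apply/canonical_truth; exact: GD.
Qed.

End Completeness.

Theorem theorem5p6 (P : Type) (p0 : P) :
  sound (@Ecirc P) all_nframes /\
  strongly_complete p0 (@Ecirc P) all_nframes.
Proof. exact: conj (@Ecirc_sound P) (Ecirc_strongly_complete p0). Qed.
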